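(* Let $g\in\mathbb C\setminus\{0\}$. For any $k\in\mathbb C$ and $m\in -g^{-1}k+g^{-1}\mathbb Z$, the submodule $I_k(W_{L^\circ}(m\beta))$ has the form $$I_k(W_{L^\circ}(m\beta))=\begin{cases}W_{L^\circ}(m\beta)&\text{if } gm+k\in\mathbb Z_{\ge0},\\ W_{L^\circ}(-g^{-1}k\beta)&\text{if } gm+k\in\mathbb Z_{\le0}.\end{cases}$$ In particular, $I_k(V_{L^\circ-k\beta^\circ})=W_{L^\circ}(-g^{-1}k\beta)$.
   Context: Let $\mathfrak h$ be a one-dimensional complex vector space with a non-degenerate symmetric bilinear form $(\cdot,\cdot)$, with Heisenberg algebra spanned by $h(n)$ ($h\in\mathfrak h,n\in\mathbb Z$) and central $K=1$, $[h(n),h'(l)]=n(h,h')\delta_{n+l,0}$. For $\gamma\in\mathfrak h$ let $M(1,\gamma)$ be the Fock module generated by $e^\gamma$ with $h(n)e^\gamma=0$ ($n>0$), $h(0)e^\gamma=(h,\gamma)e^\gamma$. Put $V_{\mathfrak h}=\bigoplus_{\gamma\in\mathfrak h}M(1,\gamma)$, $V_A=\bigoplus_{\gamma\in A}M(1,\gamma)$ for $A\subset\mathfrak h$, and define operators $e^\gamma(n)$ ($n\in\mathbb C$) on $V_{\mathfrak h}$ by $$\sum_{n\in\mathbb C}e^\gamma(n)z^{-n-1}=\exp\Bigl(\sum_{n<0}\tfrac{\gamma(n)}{-n}z^{-n}\Bigr)\exp\Bigl(\sum_{n>0}\tfrac{\gamma(n)}{-n}z^{-n}\Bigr)e_\gamma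 z^{\gamma(0)},$$ where $z^{\gamma(0)}$ acts on $M(1,\delta)$ by $z^{(\gamma,\delta)}$ and $e_\gamma:M(1,\delta)\to M(1,\gamma+\delta)$ commutes with $h(n)$, $n\neq0$, and sends $e^\delta$ to $e^{\gamma+\delta}$. Let $\beta\in\mathfrak h$ with $(\beta,\beta)=g$, $\beta^\circ=\beta/g$, $L^\circ=\mathbb Z\beta^\circ$. $W_{L^\circ}$ is the generalized vertex subalgebra of $V_{\mathfrak h}$ generated by $e^{\beta^\circ}$, and for $m\in\mathbb C$, $W_{L^\circ}(m\beta)=W_{L^\circ}\cdot e^{m\beta}$ is the cyclic $W_{L^\circ}$-module generated by $e^{m\beta}$; concretely, the smallest subspace of $V_{\mathfrak h}$ containing $e^{m\beta}$ and stable under all $e^{\beta^\circ}(n)$, $n\in\mathbb C$. For a graded $W_{L^\circ}$-submodule $R\subset V_{\mathfrak h}$ and $k\in\mathbb C$, $I_k(R)=\bigcap_{n\in\mathbb Z_{\ge0}}\ker\bigl(e^\beta(k+n)|_R:R\to V_{\mathfrak h}\bigr)$. *)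

(* Defs.v *)
From HB Require Import structures.
From mathcomp Require Import all_boot all_order all_algebra.
From mathcomp Require Import finmap.
From mathcomp Require Export monalg.
From mathcomp Require Import boolp functions cardinality.
From mathcomp Require Export classical_sets fsbigop reals complex.

Set Implicit Arguments.
Unset Strict Implicit.
Unset Printing Implicit Defensive.

Import GRing.Theory.
Local Open Scope ring_scope.
Local Open Scope classical_set_scope.

(* {malg C[K]} serves as the free C-module on the type K, with basis bvec C x;
   lin_ext f is the linear map sending bvec C x to f x. *)
HB.lock Definition bvec (C : nzRingType) (K : choiceType) (x : K) : {malg C[K]} :=
  << x >>.

HB.lock Definition lin_ext (C : nzRingType) (K : choiceType) (V : lmodType C)
    (f : K -> V) (v : {malg C[K]}) : V := \sum_(x <- msupp v) v@_x *: f x.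

Section LinExt.
Context (C : nzRingType) (K : choiceType) (V : lmodType C).
Implicit Types (f : K -> V) (u v : {malg C[K]}).

Lemma lin_ext_is_linear f : linear (lin_ext f).
Proof.
have E v (D : {fset K}) : (msupp v `<=` D)%fset ->
    lin_ext f v = \sum_(x <- D) v@_x *: f x.
  move=> vD; rewrite lin_ext.unlock (big_fset_incl _ vD) // => x _ /mcoeff_outdom ->.
  by rewrite scale0r.
move=> c u v; set D := (msupp u `|` msupp v)%fset.
have uD : (msupp u `<=` D)%fset by exact: fsubsetUl.
have vD : (msupp v `<=` D)%fset by exact: fsubsetUr.
have cD : (msupp (c *: u + v) `<=` D)%fset.
  by apply: fsubset_trans (msuppD_le _ _) _; rewrite fsetSU ?msuppZ_le.
rewrite (E _ _ cD) (E _ _ uD) (E _ _ vD) scaler_sumr -big_split /=.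
by apply: eq_bigr => x _; rewrite mcoeffD mcoeffZ scalerDl scalerA.
Qed.

HB.instance Definition _ f :=
  GRing.isLinear.Build C {malg C[K]} V *:%R (lin_ext f) (lin_ext_is_linear f).

Lemma lin_ext_bvec f x : lin_ext f (bvec C x) = f x.
Proof.
by rewrite lin_ext.unlock bvec.unlock msuppU oner_eq0 big_seq_fset1 mcoeffUU scale1r.
Qed.

Lemma eq_linear_bvec (f g : {linear {malg C[K]} -> V}) :
  (forall x, f (bvec C x) = g (bvec C x)) -> f =1 g.
Proof.
move=> fg v; rewrite [v]monalgE !linear_sum; apply: eq_bigr => x _.
have -> : << v@_x *g x >> = v@_x *: bvec C x.
  by apply/malgP => y; rewrite bvec.unlock mcoeffZ !mcoeffU mulrnAr mulr1.
by rewrite !linearZ fg.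
Qed.

End LinExt.

Section Cmonom.
Context (I : choiceType).
Implicit Types (m : {cmonom I}) (x y : I).

Lemma divcmAC m x y :
  divcm (divcm m (ucm x)) (ucm y) = divcm (divcm m (ucm y)) (ucm x).
Proof. by apply/eqP/cmP => z; rewrite !divcmE subnAC. Qed.

Lemma ucmMK m x : divcm (mmul (ucm x) m) (ucm x) = m.
Proof. by apply/eqP/cmP => z; rewrite divcmE cmM addnC addnK. Qed.

Lemma ucm_divK m x : (0 < m x)%N -> mmul (ucm x) (divcm m (ucm x)) = m.
Proof.
move=> mx; apply/eqP/cmP => z; rewrite cmM divcmE cmU.
by case: eqP => [<-|_]; rewrite ?subn0 // subnKC.
Qed.

Lemma divcm_mul_neq m x y : x != y ->
  divcm (mmul (ucm y) m) (ucm x) = mmul (ucm y) (divcm m (ucm x)).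
Proof.
move=> xy; apply/eqP/cmP => z; rewrite cmM !divcmE cmM !cmU.
have [<-|_] := eqVneq x z; last by rewrite !subn0.
by rewrite [y == _]eq_sym (negPf xy).
Qed.

Lemma ucmM_eqE m x y : mmul (ucm y) m x = ((x == y) + m x)%N.
Proof. by rewrite cmM cmU eq_sym. Qed.

Lemma divcm_ucm_coef (A : comNzRingType) m x y :
  (m x)%:R * (divcm m (ucm x) y)%:R =
  (m y)%:R * (divcm m (ucm y) x)%:R :> A.
Proof.
rewrite !divcmE !cmU [y == x]eq_sym.
by have [->|_] := eqVneq x y; rewrite ?subn0 // mulrC.
Qed.

Lemma divcm_termC (A : comNzRingType) (V : lmodType A) (f : {cmonom I} -> V)
    (p q : A) m x y :
  (p * (m x)%:R) *: ((q * (divcm m (ucm x) y)%:R) *: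
     f (divcm (divcm m (ucm x)) (ucm y))) =
  (q * (m y)%:R) *: ((p * (divcm m (ucm y) x)%:R) *:
     f (divcm (divcm m (ucm y)) (ucm x))).
Proof.
rewrite [LHS]scalerA [RHS]scalerA (divcmAC m x y) mulrACA divcm_ucm_coef.
by rewrite (mulrC p q) mulrACA.
Qed.

Lemma mulm_divcm_term (A : comNzRingType) (V : lmodType A)
    (f : {cmonom I} -> V) (p q : A) m x y :
  p *: ((q * (mmul (ucm y) m x)%:R) *: f (divcm (mmul (ucm y) m) (ucm x))) =
  (q * (m x)%:R) *: (p *: f (mmul (ucm y) (divcm m (ucm x)))) +
  (q * p * (x == y)%:R) *: f m.
Proof.
rewrite [LHS]scalerA scalerA ucmM_eqE; have [->|ne] := eqVneq x y.
  rewrite (ucmMK m y); have [mu0|mu_gt0] := posnP (m y).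
    rewrite mu0 addn0 mulr0 mul0r scale0r add0r !mulr1.
    by rewrite (mulrC p q).
  rewrite (ucm_divK mu_gt0) -scalerDl natrD !mulr1 mulrDr mulrDr mulr1 addrC.
  by rewrite mulrA (mulrC p q) mulrAC.
rewrite mulr0 scale0r addr0 add0n (mulrC p).
by rewrite (divcm_mul_neq m ne).
Qed.

Lemma mulm_termC (A : comNzRingType) (V : lmodType A)
    (f : {cmonom I} -> V) (p q : A) m x y :
  p *: (q *: f (mmul (ucm x) (mmul (ucm y) m))) =
  q *: (p *: f (mmul (ucm y) (mmul (ucm x) m))).
Proof. by rewrite [LHS]scalerA [RHS]scalerA (mulrC p) mulmA (mulmC (ucm x)) -mulmA. Qed.

End Cmonom.

Section Fock.
(* The constructions make sense over any field C of characteristic 0; the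
   complex numbers are the case C = R[i] for R : realType. *)
Context (C : fieldType) (h : vectType C) (form : {symmetric h}).
Local Notation d := (\dim {:h}).
Local Notation b := (vbasis {:h}).

(* A basis of V_h.  Let b_a be the chosen basis of h.  The pair (delta, mu)
   is the vector \prod_(a, i) b_a(-(i+1)) ^ mu (a, i) . e^delta of
   M(1, delta); the variable (a, i) of the commutative monomial mu stands for
   the creation operator b_a(-(i+1)). *)
Definition fock_index : choiceType := (h * {cmonom ('I_d * nat)%type})%type.

Local Notation V_h := {malg C[fock_index]}.

Local Notation bvec x := (bvec C (x : fock_index)).

Definition e_vec (delta : h) : V_h := bvec (delta, mone).

(* gamma(n) on M(1, delta) = S(h (x) t^-1 C[t^-1]) e^delta: for n < 0 the
   multiplication by gamma(n), for n > 0 the derivation taking h'(-n) to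
   n (gamma, h'), and gamma(0) = (gamma, delta).  The Heisenberg relations are
   [heis_comm]; that e^delta generates M(1, delta) is [Fock_cyclic]. *)
Definition heis (gamma : h) (n : int) : V_h -> V_h :=
  lin_ext (fun x => let: (delta, mu) := x in
    match n with
    | Posz 0 => form gamma delta *: bvec x
    | Posz i.+1 => \sum_(a < d)
        (i.+1%:R * form gamma b`_a * (mu (a, i))%:R)
          *: bvec (delta, divcm mu (ucm (a, i)))
    | Negz i => \sum_(a < d)
        coord b a gamma *: bvec (delta, mmul (ucm (a, i)) mu)
    end).

(* e_gamma *)
Definition shift (gamma : h) : V_h -> V_h :=
  lin_ext (fun x => bvec (gamma + x.1, x.2)).

(* V_A: the vectors whose components outside the M(1, gamma), gamma in A,
   vanish *)
Definition V_sub (A : set h) : set V_h :=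
  [set v | forall x, x \in msupp v -> A x.1].

HB.instance Definition _ gamma n := GRing.Linear.on (heis gamma n).
HB.instance Definition _ gamma := GRing.Linear.on (shift gamma).

Lemma form_sym x y : form x y = form y x.
Proof. by rewrite [LHS]hermitian_subproof expr0 mul1r. Qed.

Lemma heisZ gamma n c v : heis gamma n (c *: v) = c *: heis gamma n v.
Proof. exact: linearZ. Qed.

Lemma heis_sum gamma n (I : finType) (F : I -> V_h) :
  heis gamma n (\sum_i F i) = \sum_i heis gamma n (F i).
Proof. exact: linear_sum. Qed.

Lemma heis0E gamma delta mu :
  heis gamma 0 (bvec (delta, mu)) = form gamma delta *: bvec (delta, mu).
Proof. by rewrite /heis lin_ext_bvec. Qed.

Lemma heis_posE gamma i delta mu :
  heis gamma (Posz i.+1) (bvec (delta, mu)) =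
  \sum_(a < d) (i.+1%:R * form gamma b`_a * (mu (a, i))%:R) *:
                 bvec (delta, divcm mu (ucm (a, i))).
Proof. by rewrite /heis lin_ext_bvec. Qed.

Lemma heis_negE gamma i delta mu :
  heis gamma (Negz i) (bvec (delta, mu)) =
  \sum_(a < d) coord b a gamma *: bvec (delta, mmul (ucm (a, i)) mu).
Proof. by rewrite /heis lin_ext_bvec. Qed.

Lemma shiftE gamma delta mu :
  shift gamma (bvec (delta, mu)) = bvec (gamma + delta, mu).
Proof. by rewrite /shift lin_ext_bvec. Qed.

Lemma heis_e_vec_pos gamma delta (i : nat) :
  heis gamma i.+1%:Z (e_vec delta) = 0.
Proof.
rewrite /e_vec heis_posE big1 // => a _.
by rewrite cm1 mulr0 scale0r.
Qed.

Lemma heis_e_vec0 gamma delta :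
  heis gamma 0 (e_vec delta) = form gamma delta *: e_vec delta.
Proof. exact: heis0E. Qed.

Lemma shift_e_vec gamma delta : shift gamma (e_vec delta) = e_vec (gamma + delta).
Proof. exact: shiftE. Qed.

Lemma shift_heis gamma gamma' n v : n != 0 ->
  shift gamma (heis gamma' n v) = heis gamma' n (shift gamma v).
Proof.
move=> n0; move: v; apply: (eq_linear_bvec (f := shift gamma \o heis gamma' n)
  (g := heis gamma' n \o shift gamma)) => -[delta mu] /=.
rewrite shiftE; case: n n0 => [[|i]|i] // _; rewrite ?heis_posE ?heis_negE.
  by rewrite linear_sum; apply: eq_bigr => a _; rewrite linearZ /= shiftE.
by rewrite linear_sum; apply: eq_bigr => a _; rewrite linearZ /= shiftE.
Qed.

Lemma heis_comm_zero gamma gamma' n v :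
  heis gamma 0 (heis gamma' n v) = heis gamma' n (heis gamma 0 v).
Proof.
move: v; apply: (eq_linear_bvec (f := heis gamma 0 \o heis gamma' n)
  (g := heis gamma' n \o heis gamma 0)) => -[delta mu] /=.
rewrite heis0E heisZ; case: n => [[|i]|i].
- by rewrite heis0E heisZ heis0E !scalerA mulrC.
- rewrite heis_posE heis_sum scaler_sumr; apply: eq_bigr => a _.
  by rewrite heisZ heis0E !scalerA mulrC.
- rewrite heis_negE heis_sum scaler_sumr; apply: eq_bigr => a _.
  by rewrite heisZ heis0E !scalerA mulrC.
Qed.

Lemma heis_comm_pos gamma gamma' i j v :
  heis gamma (Posz i.+1) (heis gamma' (Posz j.+1) v) =
  heis gamma' (Posz j.+1) (heis gamma (Posz i.+1) v).
Proof.
move: v; apply: (eq_linear_bvec (f := heis gamma (Posz i.+1) \o heis gamma' (Posz j.+1))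
  (g := heis gamma' (Posz j.+1) \o heis gamma (Posz i.+1))) => -[delta mu] /=.
rewrite !heis_posE !heis_sum.
transitivity (\sum_(a < d) \sum_(c < d)
   (j.+1%:R * form gamma' b`_a * (mu (a, j))%:R) *:
   ((i.+1%:R * form gamma b`_c * (divcm mu (ucm (a, j)) (c, i))%:R) *:
      bvec (delta, divcm (divcm mu (ucm (a, j))) (ucm (c, i))))).
  by apply: eq_bigr => a _; rewrite heisZ heis_posE scaler_sumr.
rewrite exchange_big; apply: eq_bigr => a _.
rewrite heisZ heis_posE scaler_sumr; apply: eq_bigr => c _ /=.
exact: (divcm_termC (fun m => bvec (delta, m))).
Qed.

Lemma heis_comm_neg gamma gamma' i j v :
  heis gamma (Negz i) (heis gamma' (Negz j) v) =
  heis gamma' (Negz j) (heis gamma (Negz i) v).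
Proof.
move: v; apply: (eq_linear_bvec (f := heis gamma (Negz i) \o heis gamma' (Negz j))
  (g := heis gamma' (Negz j) \o heis gamma (Negz i))) => -[delta mu] /=.
rewrite !heis_negE !heis_sum.
transitivity (\sum_(a < d) \sum_(c < d) coord b a gamma' *:
   (coord b c gamma *:
      bvec (delta, mmul (ucm (c, i)) (mmul (ucm (a, j)) mu)))).
  by apply: eq_bigr => a _; rewrite heisZ heis_negE scaler_sumr.
rewrite exchange_big; apply: eq_bigr => a _.
rewrite heisZ heis_negE scaler_sumr; apply: eq_bigr => c _ /=.
exact: (mulm_termC (fun m => bvec (delta, m))).
Qed.

Lemma form_coord gamma gamma' :
  \sum_(a < d) form gamma b`_a * coord b a gamma' = form gamma gamma'.
Proof.
rewrite [in RHS](coord_vbasis (memvf gamma')) linear_sum.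
by apply: eq_bigr => a _; rewrite linearZ mulrC.
Qed.

Lemma heis_comm_pos_neg gamma gamma' i j v :
  heis gamma (Posz i.+1) (heis gamma' (Negz j) v) =
  heis gamma' (Negz j) (heis gamma (Posz i.+1) v)
    + (i.+1%:R * form gamma gamma' * (i == j)%:R) *: v.
Proof.
move: v; apply: (eq_linear_bvec (f := heis gamma (Posz i.+1) \o heis gamma' (Negz j))
  (g := (heis gamma' (Negz j) \o heis gamma (Posz i.+1)) \+
    ( *:%R (i.+1%:R * form gamma gamma' * (i == j)%:R) \o idfun))) => -[delta mu] /=.
rewrite heis_negE heis_posE !heis_sum.
transitivity (\sum_(a < d) \sum_(c < d) coord b a gamma' *:
   ((i.+1%:R * form gamma b`_c * (mmul (ucm (a, j)) mu (c, i))%:R) *: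
      bvec (delta, divcm (mmul (ucm (a, j)) mu) (ucm (c, i))))).
  by apply: eq_bigr => a _; rewrite heisZ heis_posE scaler_sumr.
rewrite exchange_big -form_coord mulr_sumr mulr_suml scaler_suml -big_split.
apply: eq_bigr => c _; rewrite heisZ heis_negE scaler_sumr /=.
rewrite [X in _ = _ + X](_ : _ = \sum_(a < d) (i.+1%:R * form gamma b`_c *
   coord b a gamma' * ((c, i) == (a, j))%:R) *: bvec (delta, mu)); last first.
  rewrite (bigD1 c) //= big1 ?addr0 => [|a /negPf ac].
    by rewrite xpair_eqE eqxx /= !mulrA.
  by rewrite xpair_eqE eq_sym ac mulr0 scale0r.
rewrite -big_split; apply: eq_bigr => a _ /=.
exact: (mulm_divcm_term (fun m => bvec (delta, m))).
Qed.

Lemma heis_comm gamma gamma' (n l : int) v :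
  heis gamma n (heis gamma' l v) - heis gamma' l (heis gamma n v) =
    (n%:~R * form gamma gamma' * (n + l == 0)%:R) *: v.
Proof.
have neg i : Negz i = - (i.+1)%:Z by rewrite NegzE.
case: n => [[|i]|i]; first by rewrite heis_comm_zero subrr !mul0r scale0r.
  case: l => [[|j]|j].
  - by rewrite heis_comm_zero subrr mulr0 scale0r.
  - by rewrite heis_comm_pos subrr mulr0 scale0r.
  - by rewrite heis_comm_pos_neg addrC addKr neg subr_eq0.
case: l => [[|j]|j].
- by rewrite heis_comm_zero subrr mulr0 scale0r.
- rewrite heis_comm_pos_neg opprD addNKr neg.
  rewrite -scaleNr addrC subr_eq0 form_sym eqz_nat eqSS.
  case: (eqVneq j i) => [->|_]; last by rewrite !mulr0 oppr0.
  by rewrite !mulr1 mulrNz mulNr.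
- by rewrite heis_comm_neg subrr mulr0 scale0r.
Qed.

Definition is_subspace (U : set V_h) : Prop :=
  U 0 /\ forall (c : C) u v, U u -> U v -> U (c *: u + v).

Lemma is_subspace_sum (U : set V_h) (I : Type) (r : seq I) (P : pred I) F :
  is_subspace U -> (forall i, P i -> U (F i)) -> U (\sum_(i <- r | P i) F i).
Proof.
case=> U0 UD UF; elim/big_ind: _ => // u v Uu Uv.
by have := UD 1 u v Uu Uv; rewrite scale1r.
Qed.

Lemma is_subspaceZ (U : set V_h) c v : is_subspace U -> U v -> U (c *: v).
Proof. by case=> U0 UD Uv; have := UD c v 0 Uv U0; rewrite addr0. Qed.

Lemma Fock_cyclic (U : set V_h) delta mu : is_subspace U ->
    (forall gamma n v, U v -> U (heis gamma n v)) -> U (e_vec delta) ->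
  U (bvec (delta, mu)).
Proof.
move=> subU stU Ue; have [n] := ubnP (mdeg mu); elim: n mu => // n IHn mu.
have [->|/eqP mu1] := eqVneq mu mone; first by move=> _; exact: Ue.
have [fs0|[[a i]]] := fset_0Vmem (finsupp mu).
  by case: mu1; apply/eqP/cmP => x; rewrite cm1; apply/eqP; rewrite cmE_eq0 fs0.
rewrite -cmE_neq0 -lt0n => mu_gt0; rewrite -[mu in mdeg mu](ucm_divK mu_gt0).
rewrite mdegM mdegU add1n ltnS => /IHn/(stU b`_a (Negz i)).
rewrite heis_negE (bigD1 a) //= big1 ?addr0 => [|c ca].
  by rewrite coord_free ?(basis_free (vbasisP _)) // eqxx scale1r ucm_divK.
rewrite coord_free ?(basis_free (vbasisP _)) //.
by rewrite [a == c]eq_sym (negPf ca) scale0r.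
Qed.

(* Power series in one variable with operator coefficients; [F n] is the
   coefficient of degree n. *)
Definition opseries := nat -> V_h -> V_h.

Definition opser_mul (F G : opseries) : opseries :=
  fun n v => \sum_(i < n.+1) F i (G (n - i)%N v).

Definition opser_one : opseries := fun n v => if n is 0 then v else 0.

(* Used for series F with F 0 = 0, for which F^j has no term of degree n < j:
   the sum over j below is then the whole exponential sum. *)
Definition opser_exp (F : opseries) : opseries :=
  fun n v => \sum_(j < n.+1) (j`!%:R)^-1 *: iter j (opser_mul F) opser_one n v.

(* \sum_(n < 0) gamma(n)/(-n) z^-n, as a series in z *)
Definition creation_ser (gamma : h) : opseries :=
  fun n v => if n is i.+1 then (n%:R)^-1 *: heis gamma (- n%:Z) v else 0.

(* \sum_(n > 0) gamma(n)/(-n) z^-n, as a series in z^-1 *)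
Definition annihilation_ser (gamma : h) : opseries :=
  fun n v => if n is i.+1 then (- n%:R)^-1 *: heis gamma n%:Z v else 0.

(* On M(1, delta), the coefficient of z^(-n-1) collects the products of the
   degree p.1 coefficient of the first exponential (in z) and the degree p.2
   coefficient of the second one (in z^-1) with
   p.1 - p.2 + (gamma, delta) = -n-1.  Only finitely many of them are nonzero
   on a given vector (see [vop_finite]), so that the finitely supported sum in
   [vop] is the whole coefficient. *)
Definition vop_index (gamma : h) (n : C) (delta : h) : set (nat * nat) :=
  [set p | p.1%:R - p.2%:R + form gamma delta = - n - 1].

Definition vop_term (gamma : h) (v : V_h) (p : nat * nat) : V_h :=
  opser_exp (creation_ser gamma) p.1
    (opser_exp (annihilation_ser gamma) p.2 (shift gamma v)).

(* The conformal-weight grading on monomials, used for [vop_finite]. *)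
Definition wt (mu : {cmonom ('I_d * nat)%type}) : nat :=
  \sum_(x <- finsupp mu) mu x * x.2.+1.

Lemma wtM mu nu : wt (mmul mu nu) = (wt mu + wt nu)%N.
Proof.
have E (m : {cmonom ('I_d * nat)%type}) (D : {fset ('I_d * nat)%type}) : (finsupp m `<=` D)%fset ->
    wt m = (\sum_(x <- D) m x * x.2.+1)%N.
  move=> mD; rewrite /wt (big_fset_incl _ mD) // => x _.
  by rewrite -cmE_neq0 negbK => /eqP ->.
rewrite (E mu _ (fsubsetUl _ (finsupp nu))) (E nu _ (fsubsetUr (finsupp mu) _)).
rewrite /wt mdomD -big_split /=; apply: eq_bigr => x _.
by rewrite cmM mulnDl.
Qed.

Lemma wt_ucm x : wt (ucm x) = x.2.+1.
Proof. by rewrite /wt mdomU big_seq_fset1 cmUU mul1n. Qed.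

Definition wt_lt (N : nat) : set V_h :=
  [set v | forall x, x \in msupp v -> (wt x.2 < N)%N].

Lemma wt_lt_subspace N : is_subspace (wt_lt N).
Proof.
split=> [x|c u v uN vN x]; first by rewrite msupp0.
move/(fsubsetP (msuppD_le _ _)); rewrite in_fsetU => /orP[|/vN //].
by move/(fsubsetP (msuppZ_le _ _))/uN.
Qed.

Lemma wt_ltZ N c v : wt_lt N v -> wt_lt N (c *: v).
Proof. by move=> vN; apply: (is_subspaceZ _ (wt_lt_subspace N)). Qed.

Lemma wt_lt_sum N (I : Type) (r : seq I) (P : pred I) F :
  (forall i, P i -> wt_lt N (F i)) -> wt_lt N (\sum_(i <- r | P i) F i).
Proof. exact: (@is_subspace_sum (wt_lt N) I r P F (wt_lt_subspace N)). Qed.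

Lemma wt_lt_bvec N delta mu : (wt mu < N)%N -> wt_lt N (bvec (delta, mu)).
Proof. by move=> muN x; rewrite bvec.unlock msuppU oner_eq0 in_fset1 => /eqP ->. Qed.

Lemma wt_lt0 v : wt_lt 0 v -> v = 0.
Proof.
move=> v0; apply/malgP => x; rewrite mcoeff0 mcoeff_outdom //.
by apply/negP => /v0.
Qed.

Lemma wt_lt_heis gamma i N v :
  wt_lt N v -> wt_lt (N - i.+1) (heis gamma i.+1%:Z v).
Proof.
move=> vN; rewrite /heis lin_ext.unlock big_seq.
apply: wt_lt_sum => -[delta mu] /vN /= muN.
apply: wt_ltZ.
apply: wt_lt_sum => a _.
have [->|mu_gt0] := posnP (mu (a, i)).
  by rewrite mulr0 scale0r; case: (wt_lt_subspace (N - i.+1)).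
apply: wt_ltZ.
apply: wt_lt_bvec; rewrite ltn_subRL; apply: leq_ltn_trans muN.
by rewrite -[in leqRHS](ucm_divK mu_gt0) wtM wt_ucm.
Qed.

Definition wt_lowering (F : opseries) : Prop :=
  forall n N v, wt_lt N v -> wt_lt (N - n) (F n v).

Lemma wt_lowering_exp F : wt_lowering F -> wt_lowering (opser_exp F).
Proof.
move=> lF; have lM G : wt_lowering G -> wt_lowering (opser_mul F G).
  move=> lG n N v vN; apply: wt_lt_sum => i _.
  have -> : (N - n = N - (n - i) - i)%N by rewrite -subnDA subnK // -ltnS.
  exact/lF/lG.
move=> n N v vN; apply: wt_lt_sum => j _.
apply: wt_ltZ.
move: (j : nat) => {j} k; elim: k n N v vN => [[|n] N v vN|k IHk] /=.
- by rewrite subn0.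
- by case: (wt_lt_subspace (N - n.+1)).
- exact: lM.
Qed.

Lemma opser_exp0 F n : (forall n, F n 0 = 0) -> opser_exp F n 0 = 0.
Proof.
move=> F0; rewrite /opser_exp big1 // => j _.
suff -> : iter j (opser_mul F) opser_one n 0 = 0 by rewrite scaler0.
move: (j : nat) => {j} k; elim: k n => [[]//|k IHk n] /=.
by rewrite /opser_mul big1 // => i _; rewrite IHk F0.
Qed.

Lemma vop_finite gamma n delta v : [pchar C] =i pred0 ->
  finite_set (vop_index gamma n delta `&`
              vop_term gamma v @^-1` [set~ 0]).
Proof.
move=> /pcharf0P C0.
pose N := (\max_(x <- msupp (shift gamma v)) (wt x.2).+1)%N.
have vN : wt_lt N (shift gamma v).
  by move=> x xv; rewrite /N (big_fsetD1 x xv) /= leq_max leqnn.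
have term0 p : (N <= p.2)%N -> vop_term gamma v p = 0.
  rewrite -subn_eq0 => /eqP Np; rewrite /vop_term.
  have -> : opser_exp (annihilation_ser gamma) p.2 (shift gamma v) = 0.
    apply: wt_lt0; rewrite -Np; apply: wt_lowering_exp => // -[|m] M w wM /=.
      by case: (wt_lt_subspace (M - 0)).
    exact/wt_ltZ/wt_lt_heis.
  by apply: opser_exp0 => -[|m] //=; rewrite linear0 scaler0.
have inj (p q : nat * nat) : vop_index gamma n delta p ->
    vop_index gamma n delta q -> p.2 = q.2 -> p = q.
  case: p q => [p1 p2] [q1 q2]; rewrite /vop_index /= => <- + p2q2.
  rewrite p2q2 => /addIr/addIr/eqP; rewrite eq_sym.
  suff E : forall a c : nat, (a <= c)%N -> a%:R == c%:R :> C -> a = c.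
    case: (leqP p1 q1) => [le /(E _ _ le) ->//|/ltnW le].
    by rewrite eq_sym => /(E _ _ le) ->.
  move=> a c ac; rewrite eq_sym -subr_eq0 -natrB // C0 subn_eq0 => ca.
  by apply/eqP; rewrite eqn_leq ac.
pose at2 (j : nat) := [set p | vop_index gamma n delta p /\ p.2 = j].
apply: (@sub_finite_set _ _ (\bigcup_(j in `I_N) at2 j)).
  move=> p [ip /= /eqP pn0]; exists p.2; last by [].
  by rewrite /= ltnNge; apply/negP => /term0 p0; rewrite p0 eqxx in pn0.
apply: bigcup_finite => [|j _]; first exact: finite_II.
have [[p [ip pj]]|no] := pselect (exists p, at2 j p).
  apply: (@sub_finite_set _ _ [set p]); last exact: finite_set1.
  by move=> q [iq qj]; apply: inj; rewrite // pj.
rewrite (_ : at2 j = set0); first exact: finite_set0.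
by apply/seteqP; split=> // p jp; apply: no; exists p.
Qed.

Definition vop (gamma : h) (n : C) : V_h -> V_h :=
  lin_ext (fun x => \sum_(p \in vop_index gamma n x.1)
    vop_term gamma (bvec x) p).

(* The smallest subspace containing e^mu and stable under all e^alpha(n). *)
Definition W_cyclic (alpha mu : h) : set V_h :=
  smallest
    [set U | is_subspace U /\ forall n v, U v -> U (vop alpha n v)]
    [set e_vec mu].

Definition I_ker (beta : h) (k : C) (U : set V_h) : set V_h :=
  [set v | U v /\ forall n : nat, vop beta (k + n%:R) v = 0].

End Fock.

Arguments V_sub {C h} A.

(* Main.v *)
Require Import Defs.
From mathcomp Require Import all_boot all_order all_algebra.
From HB Require Import structures.
From mathcomp Require Import finmap ring.
From mathcomp Require Import boolp.

(** Write a for beta0, so that (beta, a) = 1, and put charge c = (c - k) a.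
    All the Fock modules that occur are M(1, charge j) with j an integer.  The
    creation half of e^a and the annihilation half of e^beta are
      H_n = coefficient of z^n in exp (\sum_(n > 0) a(-n) z^n / n)
      E_r = coefficient of z^-r in exp (- \sum_(n > 0) beta(n) z^-n / n).
    If a(-n) is read as the power sum p_n of symmetric functions, H_n is the
    multiplication by the complete symmetric function h_n, and E_r is, up to
    sign, the adjoint of the multiplication by the elementary symmetric
    function e_r.  The exponentials satisfy the single commutation rule
      E_r H_n = H_n E_r - H_(n-1) E_(r-1)        ([annihilation_creation]).

    Let F be the space of vectors whose component of charge j is killed by E_r
    for every r > j, and whose components of charge not in {0, 1, 2, ...}
    vanish ([annihilation_bounded]).  It is at the same time the kernel I_k of
    the whole V_sub and the cyclic module generated in charge 0.  This settles
    the last assertion, and the other two follow: the cyclic module generated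
    in a charge j >= 0 lies in F, so it is its own kernel; the one generated
    in a charge j <= 0 lies between F and V_sub, so its kernel is F.

    F is the kernel.  On the component u of charge j, the mode e^beta(k + n)
    is the operator \sum_i X_i E_(i + r) followed by a shift, where
    r = j + n + 1 (when this is >= 0) and X_i is the creation half of e^beta,
    with X_0 = 1.  Hence F is killed, and conversely the system is triangular:
    since E_r u vanishes for large r, a descending induction on r gives
    E_r u = 0 for all r > j, including u = E_0 u = 0 if j < 0
    ([annihilation_bounded_kernel], [kernel_annihilation_bounded]).

    F is a submodule.  The commutation rule says that one application of an
    H_n raises the largest r with E_r u != 0 by at most one, and e^a(n) also
    raises the charge by one; so F is stable under e^a(n), and it contains
    the cyclic modules generated in charge j >= 0
    ([W_sub_annihilation_bounded]).

    F is generated by the vector of charge 0.  First, a vector of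
    M(1, delta) killed by all E_r with r > n is a combination of monomials
    H_(i1) ... H_(in) e^delta ([annihilation_kernel_span]).  Indeed E_n maps
    H_(i1 + 1) ... H_(in + 1) e^delta to (-1)^n H_(i1) ... H_(in) e^delta, so
    that subtracting a suitable combination of monomials from the vector
    kills E_n u, and n goes down; the combination is available because E_n u
    has smaller weight than u.  When n = 0 the vector is killed by all
    beta(i), i > 0, and is a multiple of e^delta, h being a line.  Secondly
    these monomials lie in the module generated in charge 0, because the
    leading term of e^a(n) u is H_s u shifted, and the other terms are of the
    same shape with u replaced by vectors of smaller weight
    ([creation_shift_W]). *)

Set Implicit Arguments.
Unset Strict Implicit.
Unset Printing Implicit Defensive.

Import GRing.Theory Num.Theory.
Local Open Scope ring_scope.
Local Open Scope classical_set_scope.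

(** * Exponentials of operator series *)

Section ExpRec.
Context (C : numFieldType) (V : lmodType C).
Implicit Types (T : {linear V -> V}).

(** Newton's identities: H n is the coefficient of z^n in
    exp (\sum_i A i z^(i+1) / (i+1)), written as the recursion which the
    logarithmic derivative of the exponential gives.  Everything about the
    exponentials is proved by induction on this recursion. *)
Definition exp_rec (A H : nat -> V -> V) : Prop :=
  (forall v, H 0%N v = v) /\
  (forall n v, n.+1%:R *: H n.+1 v = \sum_(i < n.+1) A i (H (n - i)%N v)).

Lemma natS_scalerI n : injective ( *:%R (n.+1%:R : C) : V -> V).
Proof. by apply: scalerI; rewrite pnatr_eq0. Qed.

Lemma exp_rec_linear A H : (forall i, linear (A i)) -> exp_rec A H ->
  forall n, linear (H n).
Proof.
move=> linA [H0 HS] n; have [m] := ubnP n; elim: m n => // m IHm [|n] nm c u v.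
  by rewrite !H0.
apply: (@natS_scalerI n); rewrite scalerDr scalerA mulrC -scalerA !HS.
rewrite scaler_sumr -big_split; apply: eq_bigr => i _ /=.
by rewrite IHm ?linA // (leq_ltn_trans (leq_subr _ _)).
Qed.

Lemma exp_rec_comm A H T : exp_rec A H ->
    (forall i v, T (A i v) = A i (T v)) ->
  forall n v, T (H n v) = H n (T v).
Proof.
move=> [H0 HS] TA n; have [m] := ubnP n; elim: m n => // m IHm [|n] nm v.
  by rewrite !H0.
apply: (@natS_scalerI n); rewrite -linearZ !HS linear_sum.
apply: eq_bigr => i _ /=.
by rewrite TA IHm // (leq_ltn_trans (leq_subr _ _)).
Qed.

Lemma exchange_triangle (W : nmodType) (F : nat -> nat -> W) n :
  \sum_(i < n.+1) \sum_(j < (n - i).+1) F i j =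
  \sum_(j < n.+1) \sum_(i < (n - j).+1) F i j.
Proof.
have E (G : nat -> nat -> W) : \sum_(i < n.+1) \sum_(j < (n - i).+1) G i j =
    \sum_(i < n.+1) \sum_(j < n.+1 | (i + j < n.+1)%N) G i j.
  apply: eq_bigr => i _; rewrite (big_ord_widen n.+1 (G i)) ?ltnS ?leq_subr //.
  by apply: eq_bigl => j; rewrite !ltnS leq_subRL // -ltnS.
rewrite (E F) (E (fun j i => F i j)) (exchange_big_dep xpredT) //=.
by apply: eq_bigr => j _; apply: eq_bigl => i; rewrite addnC.
Qed.

End ExpRec.

Section ExpHeis.
Context (C : numFieldType) (V : lmodType C).
Context (A P H : nat -> {linear V -> V}) (E : nat -> V -> V).
Hypothesis HP : exp_rec A H.
Hypothesis EP : exp_rec (fun i v => - P i v) E.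
Hypothesis comm : forall i j v,
  P i (A j v) = A j (P i v) + (i.+1%:R * (i == j)%:R) *: v.

Let H0 := HP.1.
Let HS := HP.2.
Let E0 := EP.1.
Let ES := EP.2.

(** The derivation P i acts on the exponential as on a scalar series:
    [P i, \sum_n H n z^n] = z^(i+1) \sum_n H n z^n. *)
Lemma annih_exp i n v :
  P i (H n v) = H n (P i v) + (if (i < n)%N then H (n - i.+1)%N v else 0).
Proof.
have [m] := ubnP n; elim: m n => // m IHm [|n] nm.
  by rewrite !H0 addr0.
apply: (@natS_scalerI C V n); rewrite -linearZ HS linear_sum scalerDr HS /=.
transitivity (\sum_(j < n.+1) (A j (H (n - j)%N (P i v)) +
    (if (i + j < n)%N then A j (H (n - i.+1 - j)%N v) else 0) +
    (if j == i :> nat then i.+1%:R *: H (n - i)%N v else 0))).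
  apply: eq_bigr => -[j jn] _ /=; rewrite comm IHm; last first.
    by rewrite (leq_ltn_trans (leq_subr _ _)).
  rewrite linearD /= ltn_subRL addnC; congr (_ + _ + _).
    by case: ifP => _; rewrite ?linear0 // subnAC.
  rewrite eq_sym; case: eqP => [->|_]; first by rewrite mulr1.
  by rewrite mulr0 scale0r.
rewrite big_split /= big_split /= -addrA; congr (_ + _).
rewrite -big_mkcond /= ltnS.
have [ni|ni] := leqP i n.
  rewrite subSS [X in _ + X = _](_ : _ = i.+1%:R *: H (n - i)%N v); last first.
    by rewrite -big_mkcond (big_pred1 (Ordinal (ni : (i < n.+1)%N))).
  have [-> |lt] := eqVneq n i.
    rewrite big1 ?add0r ?subnn // => j; by rewrite ltnNge leq_addr.
  have {}lt : (i < n)%N by rewrite ltn_neqAle eq_sym lt.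
  rewrite [X in X + _](_ : _ = (n - i)%:R *: H (n - i)%N v); last first.
    rewrite -(subnSK lt) HS.
    rewrite (big_ord_widen n.+1 (fun j => A j (H (n - i.+1 - j)%N v))) ?subnSK
      ?leq_subr //.
      by apply: eq_bigl => j; rewrite ltn_subRL.
    exact: leq_trans (leq_subr _ _) _.
  by rewrite -scalerDl -natrD addnS subnK.
rewrite scaler0 !big1 ?addr0 // => j.
  by case: eqP (ltn_ord j) => // -> ; rewrite ltnS leqNgt ni.
by rewrite ltnNge (leq_trans (ltnW ni)) ?leq_addr.
Qed.

(** The scalar identity behind this is exp (- \sum_i (z w)^i / i) = 1 - z w:
    moving one exponential through the other costs this factor, which is a
    polynomial because the commutators of the P i and A i are i+1 exactly. *)
Lemma exp_annih_creation r n v : E r (H n.+1 v) =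
  H n.+1 (E r v) - (if r is r'.+1 then H n (E r' v) else 0).
Proof.
have [m] := ubnP r; elim: m r => // m IHm [|r] rm.
  by rewrite !E0 subr0.
apply: (@natS_scalerI C V r); rewrite ES scalerBr -linearZ ES /=.
(* the terms created by commuting the P i telescope along f *)
pose f i := if (i < n.+1)%N then H (n - i)%N (E (r - i)%N v) else 0.
transitivity (\sum_(i < r.+1) (H n.+1 (- P i (E (r - i)%N v)) +
   ((if (i < r)%N then f i.+1 else 0) - f i) +
   (if (i < r)%N then H n (P i (E (r - i.+1)%N v)) else 0))).
  apply: eq_bigr => -[i ir] _ /=; rewrite IHm; last first.
    by rewrite (leq_ltn_trans (leq_subr _ _)).
  rewrite linearB opprB /= annih_exp ltnS subSS linearN /f ltnS.
  have [lt|le] := ltnP i r; last first.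
    rewrite (_ : (r - i = 0)%N); last by apply/eqP; rewrite subn_eq0.
    by rewrite linear0 !add0r addr0 opprD.
  rewrite -subnSK //= annih_exp opprD subnSK // !subnS ltnS.
  by rewrite addrACA -addrA addrC.
rewrite big_split big_split /= -!addrA -linear_sum; congr (_ + _).
rewrite sumrB [X in X - _ + _]big_ord_recr /= ltnn addr0.
rewrite [X in _ - X + _]big_ord_recl /=.
under eq_bigr do rewrite ltn_ord.
rewrite opprD addrCA subrr addr0 {1}/f /= !subn0 -addn1 natrD scalerDl scale1r
  opprD addrC.
rewrite addn1 big_ord_recr /= ltnn addr0.
under eq_bigr do rewrite ltn_ord.
congr (_ - _).
case: r {rm f} => [|r]; first by rewrite big_ord0 scale0r oppr0.
rewrite -linear_sum -linearZ -linearN ES -sumrN; congr (H n _).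
by apply: eq_bigr => i _; rewrite opprK subSS.
Qed.

End ExpHeis.

Section OpserExp.
Context (C : numFieldType) (h : vectType C).
Local Notation V_h := {malg C[fock_index h]}.
Context (F : nat -> {linear V_h -> V_h}).
Hypothesis F0 : forall v, F 0 v = 0.
Hypothesis FC : forall i j v, F i (F j v) = F j (F i v).

Let Fpow j : opseries h := iter j (opser_mul F) (@opser_one _ _).

Let FpowS j n v : Fpow j.+1 n v = \sum_(i < n.+1) F i (Fpow j (n - i)%N v).
Proof. by []. Qed.

Let opser_pow0 n v : Fpow 0 n.+1 v = 0.
Proof. by []. Qed.

Lemma opser_pow_low j n v : (n < j)%N -> Fpow j n v = 0.
Proof.
elim: j n => // j IHj n nj; rewrite FpowS big_ord_recl F0 add0r big1 // => i _.
rewrite IHj ?linear0 //= (@leq_trans n) // ltn_subrL /=.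
by rewrite (leq_ltn_trans _ (ltn_ord i)).
Qed.

(** Truncation of the exponential sum is immaterial, which puts the sums
    for different degrees n on the same footing. *)
Lemma opser_exp_wide B n v : (n < B)%N ->
  opser_exp F n v = \sum_(j < B) (j`!%:R)^-1 *: Fpow j n v.
Proof.
move=> nB; rewrite /opser_exp.
rewrite (big_ord_widen B (fun j => (j`!%:R)^-1 *: Fpow j n v)) //.
rewrite big_mkcond; apply: eq_bigr => j _; rewrite ltnS.
by case: leqP => // nj; rewrite opser_pow_low ?scaler0.
Qed.

(** The derivation rule (F^j)' = j F' F^(j-1), degree by degree; it needs the
    coefficients of F to commute with each other. *)
Lemma opser_pow_deriv j n v : n%:R *: Fpow j n v =
  j%:R *: \sum_(i < n.+1) i%:R *: F i (Fpow j.-1 (n - i)%N v).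
Proof.
elim: j n => [|j IHj] n.
  by case: n => [|n]; rewrite !scale0r //= scaler0.
rewrite FpowS scaler_sumr -[j.+1]addn1 natrD scalerDl scale1r addn1 /= addrC.
transitivity (\sum_(i < n.+1) (i%:R *: F i (Fpow j (n - i)%N v) +
                               F i ((n - i)%:R *: Fpow j (n - i)%N v))).
  apply: eq_bigr => i _; rewrite linearZ -scalerDl -natrD subnKC //.
  by rewrite -ltnS.
rewrite big_split; congr (_ + _) => /=.
under eq_bigr do rewrite IHj linearZ linear_sum /=.
rewrite -scaler_sumr; case: j {IHj} => [|j]; first by rewrite !scale0r.
congr (_ *: _); rewrite (exchange_triangle (fun i k =>
  F i (k%:R *: F k (Fpow j (n - i - k)%N v)))).
apply: eq_bigr => k _; rewrite FpowS linear_sum scaler_sumr.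
by apply: eq_bigr => i _; rewrite linearZ FC subnAC.
Qed.

Lemma opser_exp_rec :
  exp_rec (fun i v => i.+1%:R *: F i.+1 v) (opser_exp F).
Proof.
split=> [v|n v].
  by rewrite /opser_exp big_ord_recl big_ord0 addr0 invr1 scale1r.
rewrite (@opser_exp_wide n.+2) // scaler_sumr big_ord_recl.
rewrite [Fpow _ _ _]opser_pow0 !scaler0 add0r.
transitivity (\sum_(j < n.+1) (j`!%:R)^-1 *:
    \sum_(i < n.+1) i.+1%:R *: F i.+1 (Fpow j (n - i)%N v)).
  apply: eq_bigr => j _; rewrite scalerA mulrC -scalerA.
  rewrite (opser_pow_deriv j.+1) scalerA /bump factS natrM invfM mulrAC mulVf
    ?pnatr_eq0 // mul1r.
  by congr (_ *: _); rewrite big_ord_recl scale0r add0r.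
under eq_bigr do rewrite scaler_sumr; rewrite exchange_big /=.
apply: eq_bigr => i _; rewrite (@opser_exp_wide n.+1) ?ltnS ?leq_subr //.
rewrite linear_sum scaler_sumr; apply: eq_bigr => j _.
by rewrite [F i.+1 (_ *: _)]linearZ /= !scalerA mulrC.
Qed.

End OpserExp.

(** * The two halves of a vertex operator *)

Section Fock.
Context (C : numFieldType) (h : vectType C) (form : {symmetric h}).
Local Notation d := (\dim {:h}).
Local Notation V_h := {malg C[fock_index h]}.
Local Notation bvec x := (bvec C (x : fock_index h)).
Local Notation heis := (heis form).
Local Notation shift := (@shift C h).
Local Notation vop := (vop form).
Local Notation vop_index := (vop_index form).
Local Notation vop_term := (vop_term form).
Implicit Types (gamma delta : h) (u v : V_h).

Lemma creation_ser_linear gamma n : linear (creation_ser form gamma n).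
Proof.
by case: n => [|n] c u v; rewrite /creation_ser ?scaler0 ?addr0 // linearP
  scalerDr !scalerA mulrC.
Qed.
HB.instance Definition _ gamma n := GRing.isLinear.Build C V_h V_h *:%R
  (creation_ser form gamma n) (creation_ser_linear gamma n).

Lemma annihilation_ser_linear gamma n : linear (annihilation_ser form gamma n).
Proof.
by case: n => [|n] c u v; rewrite /annihilation_ser ?scaler0 ?addr0 // linearP
  scalerDr !scalerA mulrC.
Qed.
HB.instance Definition _ gamma n := GRing.isLinear.Build C V_h V_h *:%R
  (annihilation_ser form gamma n) (annihilation_ser_linear gamma n).

Definition creation gamma n : V_h -> V_h :=
  opser_exp (creation_ser form gamma) n.
Definition annihilation gamma n : V_h -> V_h :=
  opser_exp (annihilation_ser form gamma) n.

Lemma creation_rec gamma :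
  exp_rec (fun i v => heis gamma (Negz i) v) (creation gamma).
Proof.
have [//||X0 XS] := @opser_exp_rec C h (fun n => creation_ser form gamma n).
  move=> [|i] [|j] v; rewrite /=.
  - by [].
  - by rewrite linear0 scaler0.
  - by rewrite linear0 scaler0.
  - by rewrite !heisZ heis_comm_neg !scalerA mulrC.
split=> [|n v]; first exact: X0.
rewrite XS; apply: eq_bigr => i _.
by rewrite /= scalerA mulfV ?scale1r ?pnatr_eq0.
Qed.

Lemma annihilation_rec gamma :
  exp_rec (fun i v => - heis gamma (Posz i.+1) v) (annihilation gamma).
Proof.
have [//||X0 XS] := @opser_exp_rec C h (fun n => annihilation_ser form gamma n).
  move=> [|i] [|j] v; rewrite /=.
  - by [].
  - by rewrite linear0 scaler0.
  - by rewrite linear0 scaler0.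
  - by rewrite !heisZ heis_comm_pos !scalerA mulrC.
split=> [|n v]; first exact: X0.
rewrite XS; apply: eq_bigr => i _.
by rewrite /= scalerA invrN mulrN mulfV ?scaleN1r ?pnatr_eq0.
Qed.

Lemma creation_linear gamma n : linear (creation gamma n).
Proof.
by apply: exp_rec_linear (creation_rec gamma) _ => i; exact: linearP.
Qed.
HB.instance Definition _ gamma n := GRing.isLinear.Build C V_h V_h *:%R
  (creation gamma n) (creation_linear gamma n).

Lemma annihilation_linear gamma n : linear (annihilation gamma n).
Proof.
apply: exp_rec_linear (annihilation_rec gamma) _ => i c u v.
by rewrite linearP opprD scalerN.
Qed.
HB.instance Definition _ gamma n := GRing.isLinear.Build C V_h V_h *:%R
  (annihilation gamma n) (annihilation_linear gamma n).

Lemma creation0 gamma v : creation gamma 0 v = v.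
Proof. exact: (creation_rec gamma).1. Qed.

Lemma annihilation0 gamma v : annihilation gamma 0 v = v.
Proof. exact: (annihilation_rec gamma).1. Qed.

(** The normalization (gamma, gamma') = 1 makes the correction factor 1 - z w;
    in the theorem it is (beta, beta0) = 1. *)
Lemma annihilation_creation gamma gamma' r n v : form gamma gamma' = 1 ->
  annihilation gamma r (creation gamma' n.+1 v) =
  creation gamma' n.+1 (annihilation gamma r v) -
  (if r is r'.+1 then creation gamma' n (annihilation gamma r' v) else 0).
Proof.
move=> f1.
apply: (@exp_annih_creation _ _ (fun i => heis gamma' (Negz i))
  (fun i => heis gamma (Posz i.+1)) (fun n => creation gamma' n)
  (annihilation gamma) (creation_rec gamma') (annihilation_rec gamma)).
by move=> i j w; rewrite /= heis_comm_pos_neg f1 mulr1.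
Qed.

Lemma annihilation_heis gamma gamma' r i v :
  annihilation gamma r (heis gamma' (Posz i.+1) v) =
  heis gamma' (Posz i.+1) (annihilation gamma r v).
Proof.
apply/esym/(exp_rec_comm (T := heis gamma' (Posz i.+1))
  (annihilation_rec gamma)).
by move=> j w; rewrite linearN /= heis_comm_pos.
Qed.

Lemma annihilation_comm gamma gamma' r s v :
  annihilation gamma r (annihilation gamma' s v) =
  annihilation gamma' s (annihilation gamma r v).
Proof.
apply: (exp_rec_comm (T := annihilation gamma r) (annihilation_rec gamma')).
by move=> i w; rewrite linearN /= annihilation_heis.
Qed.

Lemma shift_creation gamma gamma' n v :
  shift gamma (creation gamma' n v) = creation gamma' n (shift gamma v).
Proof.
apply: (exp_rec_comm (T := shift gamma) (creation_rec gamma')) => i w.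
by rewrite /= shift_heis.
Qed.

Lemma shift_annihilation gamma gamma' n v :
  shift gamma (annihilation gamma' n v) = annihilation gamma' n (shift gamma v).
Proof.
apply: (exp_rec_comm (T := shift gamma) (annihilation_rec gamma')) => i w.
by rewrite linearN /= shift_heis.
Qed.

Lemma shiftK gamma v : shift (- gamma) (shift gamma v) = v.
Proof.
move: v; apply: (eq_linear_bvec (f := shift (- gamma) \o shift gamma)
  (g := idfun)).
by move=> -[delta mu] /=; rewrite !shiftE addKr.
Qed.

Lemma annihilation_e_vec gamma r delta :
  annihilation gamma r.+1 (e_vec delta) = 0.
Proof.
have [m] := ubnP r; elim: m r => // m IHm r rm.
apply: (@natS_scalerI _ _ r); rewrite scaler0 (annihilation_rec gamma).2.
rewrite big1 // => i _; case E : (r - i)%N => [|k].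
  by rewrite annihilation0 heis_e_vec_pos oppr0.
rewrite IHm ?linear0 ?oppr0 // -ltnS -E.
by rewrite (leq_trans _ rm) // ltnS leq_subr.
Qed.

(** * Decomposition by charge and by weight *)

Definition charge_proj delta : V_h -> V_h :=
  lin_ext (fun x : fock_index h => if x.1 == delta then bvec x else 0).
HB.instance Definition _ delta := GRing.Linear.on (charge_proj delta).

Lemma charge_projE delta eta mu : charge_proj delta (bvec (eta, mu)) =
  if eta == delta then bvec (eta, mu) else 0.
Proof. by rewrite /charge_proj lin_ext_bvec. Qed.

Lemma charge_proj_heis delta gamma n v :
  charge_proj delta (heis gamma n v) = heis gamma n (charge_proj delta v).
Proof.
move: v; apply: (eq_linear_bvec (f := charge_proj delta \o heis gamma n)
  (g := heis gamma n \o charge_proj delta)) => -[eta mu] /=.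
rewrite charge_projE; case: n => [[|i]|i].
- by rewrite heis0E linearZ /= charge_projE; case: ifP;
  rewrite ?heis0E ?linear0 ?scaler0.
- rewrite heis_posE linear_sum; case: ifP => eta_delta; last first.
    by rewrite linear0 big1 // => a _; rewrite linearZ /= charge_projE
      eta_delta scaler0.
  by rewrite heis_posE; apply: eq_bigr => a _;
    rewrite linearZ /= charge_projE eta_delta.
- rewrite heis_negE linear_sum; case: ifP => eta_delta; last first.
    by rewrite linear0 big1 // => a _; rewrite linearZ /= charge_projE
      eta_delta scaler0.
  by rewrite heis_negE; apply: eq_bigr => a _;
    rewrite linearZ /= charge_projE eta_delta.
Qed.

Lemma charge_proj_creation delta gamma n v :
  charge_proj delta (creation gamma n v) =
    creation gamma n (charge_proj delta v).
Proof.
apply: (exp_rec_comm (T := charge_proj delta) (creation_rec gamma)) => i w.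
exact: charge_proj_heis.
Qed.

Lemma charge_proj_annihilation delta gamma n v :
  charge_proj delta (annihilation gamma n v) =
  annihilation gamma n (charge_proj delta v).
Proof.
apply: (exp_rec_comm (T := charge_proj delta) (annihilation_rec gamma)) => i w.
by rewrite linearN /= charge_proj_heis.
Qed.

Lemma charge_proj_shift delta gamma v :
  charge_proj delta (shift gamma v) =
  shift gamma (charge_proj (delta - gamma) v).
Proof.
move: v; apply: (eq_linear_bvec (f := charge_proj delta \o shift gamma)
  (g := shift gamma \o charge_proj (delta - gamma))) => -[eta mu] /=.
rewrite shiftE !charge_projE.
have -> : (gamma + eta == delta) = (eta == delta - gamma).
  by rewrite [RHS]eq_sym subr_eq eq_sym addrC.
by case: ifP => _; rewrite ?linear0 // shiftE.
Qed.

Lemma mcoeff_bvec (x y : fock_index h) : (bvec x)@_y = (x == y)%:R.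
Proof. by rewrite bvec.unlock mcoeffU. Qed.

Lemma bvec_decomp v : v = \sum_(x <- msupp v) v@_x *: bvec x.
Proof.
rewrite [LHS]monalgE; apply: eq_bigr => x _; apply/malgP => y.
by rewrite bvec.unlock mcoeffZ !mcoeffU mulrnAr mulr1.
Qed.

Lemma mcoeff_lin_ext (f : fock_index h -> V_h) v y :
  (lin_ext f v)@_y = \sum_(x <- msupp v) v@_x * (f x)@_y.
Proof.
by rewrite lin_ext.unlock raddf_sum; apply: eq_bigr => x _ /=; rewrite mcoeffZ.
Qed.

Lemma mcoeff_charge_proj delta v x :
  (charge_proj delta v)@_x = if x.1 == delta then v@_x else 0.
Proof.
have E y : (if y.1 == delta then bvec y else 0)@_x =
    (if x.1 == delta then (y == x)%:R else 0).
  have [->|yx] := eqVneq y x; first by case: ifP;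
    rewrite ?mcoeff_bvec ?eqxx ?mcoeff0.
  by do 2 case: ifP => _; rewrite ?mcoeff_bvec ?(negPf yx) ?mcoeff0.
rewrite mcoeff_lin_ext; under eq_bigr do rewrite E.
have [xv|xv] := boolP (x \in msupp v); last first.
  rewrite (mcoeff_outdom xv) if_same big_seq big1 // => y yv.
  by have [yx|_] := eqVneq y x; [rewrite -yx yv in xv | rewrite if_same mulr0].
rewrite (big_fsetD1 x) //= eqxx big1_fset ?addr0 => [|y].
  by case: ifP; rewrite ?mulr1 ?mulr0.
by rewrite in_fsetD1 => /andP[/negPf -> _] _; rewrite if_same mulr0.
Qed.

Lemma charge_proj_id delta eta v :
  charge_proj delta (charge_proj eta v) =
  if eta == delta then charge_proj eta v else 0.
Proof.
apply/malgP => x; rewrite mcoeff_charge_proj.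
have [<-|ne] := eqVneq eta delta; first by rewrite mcoeff_charge_proj;
  case: eqP.
rewrite mcoeff_charge_proj mcoeff0; case: eqP => // ->.
by rewrite eq_sym (negPf ne).
Qed.

Lemma charge_proj_ext u v :
  (forall delta, charge_proj delta u = charge_proj delta v) -> u = v.
Proof.
move=> uv; apply/malgP => x; have /(congr1 (mcoeff x)) := uv x.1.
by rewrite !mcoeff_charge_proj eqxx.
Qed.

Lemma charge_decomp v :
  exists s : seq h, v = \sum_(delta <- s) charge_proj delta v.
Proof.
exists [fset x.1 | x in msupp v]%fset; apply/malgP => x; rewrite raddf_sum /=.
under eq_bigr do rewrite mcoeff_charge_proj.
have [xv|xv] := boolP (x \in msupp v); last first.
  by rewrite (mcoeff_outdom xv) big1 // => y _; rewrite if_same.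
rewrite (big_fsetD1 x.1) ?in_imfset //= eqxx big1_fset ?addr0 // => delta.
by rewrite in_fsetD1 => /andP[+ _] _; rewrite eq_sym => /negPf ->.
Qed.

Lemma is_subspace_charge (U : set V_h) v : is_subspace U ->
  (forall delta, U (charge_proj delta v)) -> U v.
Proof.
move=> subU Uv; have [s ->] := charge_decomp v.
exact: is_subspace_sum.
Qed.

Lemma V_subP (S : set h) v :
  V_sub S v <-> forall delta, ~ S delta -> charge_proj delta v = 0.
Proof.
split=> [Sv delta Sd|Sv x].
  apply/malgP => x; rewrite mcoeff_charge_proj mcoeff0; case: eqP => // xd.
  by apply/eqP; rewrite mcoeff_eq0; apply/negP => /Sv; rewrite xd.
rewrite -mcoeff_neq0; apply: contra_neqP => /Sv /(congr1 (mcoeff x)).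
by rewrite mcoeff_charge_proj eqxx mcoeff0.
Qed.

Lemma wt_lt_annihilation gamma n N v :
  wt_lt N v -> wt_lt (N - n) (annihilation gamma n v).
Proof.
move=> vN; apply: wt_lowering_exp => // -[|m] M w wM /=.
  by case: (@wt_lt_subspace C h (M - 0)).
exact/wt_ltZ/wt_lt_heis.
Qed.

Lemma wt_lt_shift gamma N v : wt_lt N v -> wt_lt N (shift gamma v).
Proof.
move=> vN; rewrite /shift lin_ext.unlock big_seq.
by apply: wt_lt_sum => x /vN xN; apply/wt_ltZ/wt_lt_bvec.
Qed.

Lemma wt_lt_exists v : exists N, wt_lt N v.
Proof.
exists (\max_(x <- msupp v) (wt x.2).+1)%N => x xv.
by rewrite (big_fsetD1 x xv) /= leq_max leqnn.
Qed.

Lemma annihilation_wt gamma n N v : wt_lt N v -> (N <= n)%N ->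
  annihilation gamma n v = 0.
Proof.
by move=> vN; rewrite -subn_eq0 => /eqP Nn; apply: wt_lt0; rewrite -Nn;
  apply: wt_lt_annihilation.
Qed.

(** * Modes of vertex operators as finite sums *)

HB.instance Definition _ gamma n := GRing.Linear.on (vop gamma n).

Lemma vop_termE gamma v p : vop_term gamma v p =
  creation gamma p.1 (annihilation gamma p.2 (shift gamma v)).
Proof. by []. Qed.

(** Beyond the weight of u the annihilation half vanishes, so any list that
    covers the indices p with p.2 < N computes the mode. *)
Lemma vop_charge gamma n delta N u (s : seq (nat * nat)) :
    charge_proj delta u = u -> wt_lt N u -> uniq s ->
    (forall p, p \in s -> vop_index gamma n delta p) ->
    (forall p, vop_index gamma n delta p -> (p.2 < N)%N -> p \in s) ->
  vop gamma n u = \sum_(p <- s) vop_term gamma u p.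
Proof.
move=> du uN us sI Is.
transitivity (\sum_(x <- msupp u)
    u@_x *: \sum_(p <- s) vop_term gamma (bvec x) p).
  rewrite /vop lin_ext.unlock big_seq [RHS]big_seq; apply: eq_bigr => x xu.
  have -> : x.1 = delta.
    apply/eqP; move: xu; rewrite -mcoeff_neq0 -du mcoeff_charge_proj.
    by case: ifP => // _; rewrite eqxx.
  congr (_ *: _); rewrite (fsbigE s) //.
    rewrite big_seq_cond [RHS]big_seq; apply: eq_bigl => p.
    by case: (boolP (p \in s)) => //= /sI pI; apply/mem_set.
  move=> p pI ps; have Np : (N <= p.2)%N by rewrite leqNgt; apply: contra ps;
    exact: Is.
  rewrite vop_termE (@annihilation_wt gamma p.2 N) ?linear0 //.
  by apply: wt_lt_shift; case: (x) xu => eta mu xu; exact/wt_lt_bvec/(uN _ xu).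
under eq_bigr do rewrite scaler_sumr.
rewrite exchange_big /=; apply: eq_bigr => p _.
pose f : {linear V_h -> V_h} :=
  creation gamma p.1 \o annihilation gamma p.2 \o shift gamma.
rewrite -[RHS]/(f u) [in RHS](bvec_decomp u) (linear_sum f).
by apply: eq_bigr => x _; rewrite (linearZ_LR f).
Qed.

Lemma vop_finite_sum gamma n delta u : charge_proj delta u = u ->
  exists2 s : seq (nat * nat), {in s, forall p, vop_index gamma n delta p} &
    vop gamma n u = \sum_(p <- s) vop_term gamma u p.
Proof.
move=> du; have [N uN] := wt_lt_exists u.
have [[q Iq]|no] := pselect (exists q, vop_index gamma n delta q); last first.
  by exists [::] => //; apply: (vop_charge du uN) => // p Ip; case: no;
    exists p.
exists [seq p <- allpairs pair (iota 0 (q.1 + N)) (iota 0 N) |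
         `[< vop_index gamma n delta p >]].
  by move=> p; rewrite mem_filter => /andP[/asboolP].
apply: (vop_charge du uN) => [|p|[p1 p2] Ip pN].
- by rewrite filter_uniq // allpairs_uniq ?iota_uniq // => -[? ?] [? ?].
- by rewrite mem_filter => /andP[/asboolP].
rewrite mem_filter; apply/andP; split; first exact/asboolP.
apply/allpairsP; exists (p1, p2); rewrite !mem_iota /= pN; split=> //.
move: Iq Ip; rewrite /vop_index /= => <- /addIr/eqP.
rewrite subr_eq addrAC eq_sym subr_eq -!natrD eqr_nat => /eqP E.
by rewrite (leq_ltn_trans (leq_addr q.2 p1)) // -E ltn_add2l.
Qed.

Lemma charge_proj_vop delta gamma n v :
  charge_proj delta (vop gamma n v) =
  vop gamma n (charge_proj (delta - gamma) v).
Proof.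
move: v; apply: (eq_linear_bvec (f := charge_proj delta \o vop gamma n)
  (g := vop gamma n \o charge_proj (delta - gamma))) => x /=.
have bx : bvec x = bvec (x.1, x.2) by case: x.
have [|s _ sE] := @vop_finite_sum gamma n x.1 (bvec x).
  by rewrite bx charge_projE eqxx.
have E p : charge_proj delta (vop_term gamma (bvec x) p) =
   vop_term gamma (charge_proj (delta - gamma) (bvec x)) p.
  by rewrite !vop_termE charge_proj_creation charge_proj_annihilation
    charge_proj_shift.
rewrite sE linear_sum /=; under eq_bigr do rewrite E.
rewrite [X in charge_proj _ X]bx charge_projE -bx; case: ifP => _;
  first by rewrite sE.
rewrite linear0 big1 // => p _; by rewrite vop_termE !linear0.
Qed.

(** An index is determined by its second entry: p.1 - p.2 is a fixed integer,
    s >= 0 here and - t <= 0 in the next lemma. *)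
Lemma vop_index_pos gamma n delta (s : nat) p :
  s%:R + form gamma delta = - n - 1 ->
  vop_index gamma n delta p <-> p.1 = (s + p.2)%N.
Proof.
rewrite /vop_index /= => <-; split=> [/addIr/eqP|->];
  last by rewrite natrD addrK.
by rewrite subr_eq -natrD eqr_nat => /eqP.
Qed.

Lemma vop_index_neg gamma n delta (t : nat) p :
  - t%:R + form gamma delta = - n - 1 ->
  vop_index gamma n delta p <-> p.2 = (t + p.1)%N.
Proof.
rewrite /vop_index /= => <-; split=> [/addIr/eqP|->];
  last by rewrite natrD opprD addrCA subrr addr0.
by rewrite subr_eq addrC eq_sym subr_eq -natrD eqr_nat addnC => /eqP.
Qed.

Lemma vop_pos gamma n delta (s : nat) N u :
    s%:R + form gamma delta = - n - 1 ->
    charge_proj delta u = u -> wt_lt N u ->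
  vop gamma n u =
  \sum_(i < N) creation gamma (s + i) (annihilation gamma i (shift gamma u)).
Proof.
move=> sE du uN.
rewrite (vop_charge (s := [seq ((s + i)%N, i) | i <- iota 0 N]) du uN).
- by rewrite big_map -{1}(subn0 N) -[iota _ _]/(index_iota 0 N) big_mkord;
  apply: eq_bigr.
- by rewrite map_inj_uniq ?iota_uniq // => i j [].
- by move=> p /mapP[i _ ->]; apply/(vop_index_pos _ sE).
- case=> p1 p2 /(vop_index_pos _ sE) /= -> p2N; apply/mapP; exists p2 => //.
  by rewrite mem_iota.
Qed.

Lemma vop_neg gamma n delta (t : nat) N u :
    - t%:R + form gamma delta = - n - 1 ->
    charge_proj delta u = u -> wt_lt N u ->
  vop gamma n u =
  \sum_(i < N) creation gamma i (annihilation gamma (t + i) (shift gamma u)).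
Proof.
move=> sE du uN.
rewrite (vop_charge (s := [seq (i, (t + i)%N) | i <- iota 0 N]) du uN).
- by rewrite big_map -{1}(subn0 N) -[iota _ _]/(index_iota 0 N) big_mkord;
  apply: eq_bigr.
- by rewrite map_inj_uniq ?iota_uniq // => i j [].
- by move=> p /mapP[i _ ->]; apply/(vop_index_neg _ sE).
- case=> p1 p2 /(vop_index_neg _ sE) /= -> p2N; apply/mapP; exists p1 => //.
  by rewrite mem_iota (leq_ltn_trans _ p2N) // leq_addl.
Qed.

(** * Cyclic submodules *)

Lemma W_cyclic_subspace alpha mu : is_subspace (W_cyclic form alpha mu).
Proof.
split=> [U [[sU _] _]|c u v Wu Wv U UP]; first exact: sU.1.
by apply: UP.1.1.2; [exact: Wu|exact: Wv].
Qed.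

Lemma W_cyclic_stable alpha mu n v :
  W_cyclic form alpha mu v -> W_cyclic form alpha mu (vop alpha n v).
Proof. by move=> Wv U UP; apply: UP.1.2; exact: Wv. Qed.

Lemma W_cyclic_gen alpha mu : W_cyclic form alpha mu (e_vec mu).
Proof. by move=> U [_]; apply. Qed.

Lemma W_cyclic_min alpha mu (U : set V_h) : is_subspace U ->
    (forall n v, U v -> U (vop alpha n v)) -> U (e_vec mu) ->
  W_cyclic form alpha mu `<=` U.
Proof. by move=> sU US Ue v; apply; split=> // _ ->. Qed.

Lemma wt_lt_e_vec delta : wt_lt 1 (e_vec delta : V_h).
Proof. by apply: wt_lt_bvec; rewrite /wt mdom1 big_seq_fset0. Qed.

Lemma charge_proj_e_vec delta eta : charge_proj delta (e_vec eta : V_h) =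
  if eta == delta then e_vec eta else 0.
Proof. exact: charge_projE. Qed.

(** The annihilation half of e^alpha fixes e^delta, so that the series starts
    with e^(alpha + delta) z^(alpha, delta). *)
Lemma W_cyclic_e_vec alpha mu (n : nat) :
  W_cyclic form alpha mu (e_vec (n%:R *: alpha + mu)).
Proof.
elim: n => [|n IHn]; first by rewrite scale0r add0r; exact: W_cyclic_gen.
set delta := n%:R *: alpha + mu in IHn.
have := W_cyclic_stable (- form alpha delta - 1) IHn.
rewrite (@vop_pos _ _ delta 0 1) //.
- rewrite big_ord1 creation0 annihilation0 shift_e_vec.
  by rewrite /delta addrA -add1n natrD scalerDl scale1r.
- by rewrite add0r opprD !opprK addrK.
- by rewrite charge_proj_e_vec eqxx.
- exact: wt_lt_e_vec.
Qed.

(** * Monomials in the creation operators *)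

Context (alpha beta : h) (beta_alpha : form beta alpha = 1).

Definition creation_mon (s : seq nat) delta : V_h :=
  foldr (creation alpha) (e_vec delta) s.

Lemma charge_proj_creation_mon s delta :
  charge_proj delta (creation_mon s delta) = creation_mon s delta.
Proof.
elim: s => [|n s IHs] /=; first by rewrite charge_proj_e_vec eqxx.
by rewrite charge_proj_creation IHs.
Qed.

Lemma shift_creation_mon s delta :
  shift alpha (creation_mon s delta) = creation_mon s (alpha + delta).
Proof.
elim: s => [|n s IHs] /=; first exact: shift_e_vec.
by rewrite shift_creation IHs.
Qed.

(** Each creation factor absorbs at most one unit of the degree r. *)
Lemma annihilation_creation_mon r s delta : (size s < r)%N ->
  annihilation beta r (creation_mon s delta) = 0.
Proof.
elim: s r => [|n s IHs] [//|r] /= sr; first exact: annihilation_e_vec.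
case: n => [|n]; first by rewrite creation0 IHs // ltnW.
rewrite (annihilation_creation _ _ _ beta_alpha) !IHs ?(ltnW sr) //.
by rewrite !linear0 addr0.
Qed.

(** In top degree every factor absorbs exactly one unit: only the correction
    terms H_(n-1) E_(r-1) contribute. *)
Lemma annihilation_creation_mon_top s delta :
  annihilation beta (size s) (creation_mon (map S s) delta) =
    (-1) ^+ size s *: creation_mon s delta.
Proof.
elim: s => [|n s IHs] /=; first by rewrite annihilation0 scale1r.
rewrite (annihilation_creation _ _ _ beta_alpha) IHs annihilation_creation_mon
  ?size_map //.
by rewrite linear0 sub0r linearZ /= exprS mulN1r scaleNr.
Qed.

Definition creation_span n delta : set V_h :=
  smallest (@is_subspace C h)
    [set v | exists2 s, size s = n & v = creation_mon s delta].

Lemma creation_span_subspace n delta : is_subspace (creation_span n delta).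
Proof.
split=> [U [sU _]|c u v Mu Mv U UP]; first exact: sU.1.
by apply: UP.1.2; [exact: Mu|exact: Mv].
Qed.

Lemma creation_span_gen s delta :
  creation_span (size s) delta (creation_mon s delta).
Proof. by move=> U [_]; apply; exists s. Qed.

Lemma creation_span_ind n delta (U : set V_h) : is_subspace U ->
  (forall s, size s = n -> U (creation_mon s delta)) ->
    creation_span n delta `<=` U.
Proof. by move=> sU US v; apply; split=> // w [s sn ->]; exact: US. Qed.

(** The extra factor is H_0 = 1. *)
Lemma creation_spanS n delta :
  creation_span n delta `<=` creation_span n.+1 delta.
Proof.
apply: creation_span_ind => [|s <-]; first exact: creation_span_subspace.
by have := @creation_span_gen (0%N :: s) delta; rewrite /= creation0.
Qed.

Lemma subspace_linear_eq (f f' : {linear V_h -> V_h}) :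
  is_subspace [set v | f v = f' v].
Proof.
split=> [|c u v /= fu fv]; first by rewrite /= !linear0.
by rewrite !linearP fu fv.
Qed.

Lemma creation_span_charge n delta v : creation_span n delta v ->
  charge_proj delta v = v.
Proof.
apply: (creation_span_ind
  (subspace_linear_eq (charge_proj delta) idfun)) v => s _ /=.
exact: charge_proj_creation_mon.
Qed.

Lemma creation_span_annihilation n delta v r : creation_span n delta v ->
  (n < r)%N -> annihilation beta r v = 0.
Proof.
move=> + nr; apply: (creation_span_ind
  (subspace_linear_eq (annihilation beta r) \0)) v.
by move=> s sn /=; rewrite annihilation_creation_mon ?sn.
Qed.

Lemma annihilation_span_surj n delta v : creation_span n delta v ->
  exists2 u, creation_span n delta u & annihilation beta n u = v.
Proof.
have sM := creation_span_subspace n delta.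
apply: (@creation_span_ind n delta
  [set w | exists2 u, creation_span n delta u & annihilation beta n u = w]).
  split=> [|c u w [u' Mu <-] [w' Mw <-]]; first by exists 0;
    [exact: sM.1|exact: linear0].
  by exists (c *: u' + w'); [exact: sM.2|rewrite linearP].
move=> s sn; exists ((-1) ^+ n *: creation_mon (map S s) delta).
  by apply: (is_subspaceZ _ sM); rewrite -sn -(size_map S);
    exact: creation_span_gen.
rewrite linearZ /= -sn annihilation_creation_mon_top scalerA -exprD addnn
  -mul2n exprM.
by rewrite sqrrN expr1n expr1n scale1r.
Qed.

(** In Newton's identity for E_(i+1) u all terms but - beta(i+1) u vanish. *)
Lemma heis_of_annihilation i u : (forall r, annihilation beta r.+1 u = 0) ->
  heis beta (Posz i.+1) u = 0.
Proof.
move=> Eu; have := (annihilation_rec beta).2 i u; rewrite Eu scaler0.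
rewrite big_ord_recr /= subnn annihilation0 big1 ?add0r => [/eqP|j _].
  by rewrite eq_sym oppr_eq0 => /eqP.
have -> : (i - j = (i - j).-1.+1)%N by rewrite prednK // subn_gt0.
by rewrite Eu linear0 oppr0.
Qed.

Hypothesis dim_h : d = 1%N.

Lemma ord_dim_eq (a b : 'I_d) : a = b.
Proof. by apply/val_inj; case: a b => [[|?] +] [[|?] +] /=; rewrite dim_h. Qed.

Lemma form_vbasis_neq0 (a : 'I_d) : form beta (vbasis {:h})`_a != 0.
Proof.
apply/eqP => fa; have /eqP := beta_alpha; rewrite -form_coord big1.
  by rewrite eq_sym oner_eq0.
by move=> c _; rewrite (ord_dim_eq c a) fa mul0r.
Qed.

(** This is where h has to be a line: in higher dimension the vectors killed
    by all beta(i), i > 0, also involve the directions orthogonal to beta. *)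
Lemma vacuum_const delta u : charge_proj delta u = u ->
    (forall i, heis beta (Posz i.+1) u = 0) ->
  u = u@_((delta, mone) : fock_index h) *: e_vec delta.
Proof.
move=> du Pu; apply/malgP => -[eta mu]; rewrite mcoeffZ mcoeff_bvec.
have [[<- <-]|ne] := eqVneq; first by rewrite mulr1.
rewrite mulr0 -du mcoeff_charge_proj /=; case: eqP => // eta_delta.
rewrite {}eta_delta {eta} in ne *.
have mu1 : mu != mone by apply: contra_neq ne => ->.
apply/eqP; rewrite mcoeff_eq0; apply/negP => mu_u.
have [x mx] : exists x, (0 < mu x)%N.
  apply/not_existsP => mu0; case/eqP: mu1; apply/eqP/cmP => x; rewrite cm1.
  by apply/eqP; rewrite -leqn0 leqNgt; apply/negP/mu0.
case: x mx => a i mx.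
(* beta(i+1) lowers the exponent of (a, i) and multiplies by it; since (a, i)
   is the only variable of index i, nothing else contributes to this
   coefficient *)
have := congr1 (mcoeff ((delta, divcm mu (ucm (a, i))) : fock_index h)) (Pu i).
rewrite mcoeff0 mcoeff_lin_ext.
rewrite (big_fsetD1 _ mu_u) /= big1_fset ?addr0.
  rewrite raddf_sum (bigD1 a) //= big1 ?addr0 => [|c /eqP []];
    last exact: ord_dim_eq.
  rewrite mcoeffZ mcoeff_bvec eqxx mulr1 => /eqP.
  rewrite !mulf_eq0 mcoeff_eq0 mu_u pnatr_eq0 (negPf (form_vbasis_neq0 a)) /=.
  by rewrite pnatr_eq0 -leqn0 leqNgt mx.
case=> eta nu; rewrite in_fsetD1 => /andP[ne' _] _.
rewrite raddf_sum big1 ?mulr0 // => c _;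
  rewrite /= mcoeffZ mcoeff_bvec (ord_dim_eq c a).
have [nu0|nu0] := posnP (nu (a, i)); first by rewrite nu0 mulr0 mul0r.
case: eqP => [[eta_delta nu_mu]|]; last by rewrite mulr0.
case/eqP: ne'; rewrite eta_delta; congr (_, _).
by rewrite -(ucm_divK nu0) nu_mu ucm_divK.
Qed.

(** Induction on n, and for fixed n on the weight of u: the vector E_(n+1) u
    satisfies the same hypothesis with a smaller weight, hence is a
    combination of monomials and equals E_(n+1) f for another such
    combination f; then u - f falls under the case n. *)
Lemma annihilation_kernel_span n delta u : charge_proj delta u = u ->
  (forall r, (n < r)%N -> annihilation beta r u = 0) -> creation_span n delta u.
Proof.
elim: n u => [|n IHn] u du Eu.
  rewrite (vacuum_const du) => [|i]; last first.
    by apply: heis_of_annihilation => r; exact: Eu.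
  by apply: (is_subspaceZ _ (creation_span_subspace _ _));
    exact: (@creation_span_gen [::]).
have sM := creation_span_subspace n.+1 delta.
have [N uN] := wt_lt_exists u.
elim/ltn_ind: N u du Eu uN => -[|N] IHN u du Eu uN.
  by rewrite (wt_lt0 uN); exact: sM.1.
have [f Mf Ef] : exists2 f, creation_span n.+1 delta f &
    annihilation beta n.+1 f = annihilation beta n.+1 u.
  apply: annihilation_span_surj; apply: (IHN (N.+1 - n.+1)%N).
  - by rewrite subSS ltnS leq_subr.
  - by rewrite charge_proj_annihilation du.
  - by move=> r nr; rewrite annihilation_comm Eu ?linear0.
  - exact: wt_lt_annihilation.
have uf : creation_span n.+1 delta (u - f).
  apply: (@creation_spanS n delta); apply: IHn => [|r];
    first by rewrite linearB /= du (creation_span_charge Mf).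
  rewrite leq_eqVlt => /predU1P[<-|nr]; first by rewrite linearB /= Ef subrr.
  by rewrite linearB /= Eu // (creation_span_annihilation Mf) // subrr.
by rewrite -(subrK f u) -[u - f]scale1r; exact: sM.2.
Qed.

(** * The kernel as a cyclic submodule *)

Variable k : C.

(** Labelled so that (beta, charge c) = c - k: the mode e^beta(k + n) on
    M(1, charge j) then involves only the integers j and n. *)
Definition charge (c : C) : h := (c - k) *: alpha.

Lemma form_charge c : form beta (charge c) = c - k.
Proof. by rewrite /charge linearZ /= beta_alpha mulr1. Qed.

Lemma charge_inj : injective charge.
Proof.
by move=> c c' /(congr1 (form beta)); rewrite !form_charge => /addIr.
Qed.

Lemma chargeS c : charge (c + 1) = alpha + charge c.
Proof. by rewrite /charge addrAC [_ + 1]addrC scalerDl scale1r. Qed.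

Local Notation W := (W_cyclic form alpha (charge 0)).

(** With the mode chosen so that e^alpha(s) u = \sum_j H_(i+j) (u_j shifted),
    u_j being the j-th annihilation coefficient of alpha applied to u, the
    term j = 0 is the wanted one.  The others come from vectors u_j of smaller
    weight, which satisfy the hypotheses on u since annihilation operators
    commute. *)
Lemma creation_shift_W n :
    (forall u, charge_proj (charge n%:R) u = u ->
       (forall r, (n < r)%N -> annihilation beta r u = 0) -> W u) ->
  forall u i, charge_proj (charge n%:R) u = u ->
    (forall r, (n < r)%N -> annihilation beta r u = 0) ->
  W (creation alpha i (shift alpha u)).
Proof.
move=> KW u; have [N uN] := wt_lt_exists u.
have sW := W_cyclic_subspace alpha (charge 0).
elim/ltn_ind: N u uN => -[|N] IHN u uN i du Eu.
  by rewrite (wt_lt0 uN) !linear0; exact: sW.1.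
pose delta := charge n%:R.
have := W_cyclic_stable (- (i%:R + form alpha delta) - 1) (KW u du Eu).
rewrite (@vop_pos _ _ delta i N.+1) //; last by rewrite opprD !opprK addrK.
rewrite big_ord_recl addn0 annihilation0; set w := \sum_(_ < _) _ => Ww.
rewrite -(addrK w (creation _ _ _)) addrC -scaleN1r; apply: sW.2 => //.
apply: is_subspace_sum => // j _; rewrite -shift_annihilation /=.
apply: (IHN (N.+1 - (bump 0 j))%N).
- by rewrite /bump subSS ltnS leq_subr.
- exact: wt_lt_annihilation.
- by rewrite charge_proj_annihilation du.
- by move=> r nr; rewrite annihilation_comm Eu ?linear0.
Qed.

Lemma annihilation_kernel_W n u : charge_proj (charge n%:R) u = u ->
  (forall r, (n < r)%N -> annihilation beta r u = 0) -> W u.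
Proof.
elim: n u => [|n IHn] u du Eu;
  apply: (creation_span_ind (W_cyclic_subspace _ _) _
    (annihilation_kernel_span du Eu)).
  by case=> // _; exact: W_cyclic_gen.
case=> [//|i s] [sn]; rewrite /= -natr1 chargeS -shift_creation_mon.
apply: creation_shift_W IHn _ _ _ _; first exact: charge_proj_creation_mon.
by move=> r nr; rewrite annihilation_creation_mon ?sn.
Qed.

(** For delta = charge j%:R the condition is E_r = 0 on the component for
    r > j; for any other delta it includes r = 0, and as E_0 = 1 the component
    itself vanishes. *)
Definition annihilation_bounded : set V_h := [set v | forall delta r,
  (forall j : nat, delta = charge j%:R -> (j < r)%N) ->
  annihilation beta r (charge_proj delta v) = 0].
Local Notation F := annihilation_bounded.

Lemma annihilation_bounded_subspace : is_subspace F.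
Proof.
split=> [delta r _|c u v Fu Fv delta r dr]; first by rewrite !linear0.
by rewrite linearP /= linearP /= Fu // Fv // scaler0 addr0.
Qed.

Lemma annihilation_bounded_e_vec (n : nat) : F (e_vec (charge n%:R)).
Proof.
move=> delta r dr; rewrite charge_proj_e_vec; case: eqP => [d_n|];
  last by rewrite linear0.
by case: r dr => [/(_ _ (esym d_n))//|r _]; exact: annihilation_e_vec.
Qed.

(** The charge goes up by one, and the largest r with E_r u <> 0 by at most one,
    because of the term H_(n-1) E_(r-1) of the commutation rule. *)
Lemma annihilation_bounded_stable n v : F v -> F (vop alpha n v).
Proof.
move=> Fv delta r dr; rewrite charge_proj_vop.
set eta := delta - alpha; set u := charge_proj eta v.
have Er : annihilation beta r u = 0.
  by apply: Fv => j eta_j; apply/ltnW/dr;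
    rewrite -natr1 chargeS -eta_j addrC subrK.
have Er1 : forall r', r = r'.+1 -> annihilation beta r' u = 0.
  move=> r' rr'; apply: Fv => j eta_j.
  by rewrite -ltnS -rr'; apply: dr; rewrite -natr1 chargeS -eta_j addrC subrK.
have du : charge_proj eta u = u by rewrite charge_proj_id eqxx.
have [s _ ->] := vop_finite_sum alpha n du.
rewrite linear_sum big1 // => -[p1 p2] _ /=; rewrite vop_termE /=.
set w := annihilation alpha p2 (shift alpha u).
have Ew r' : annihilation beta r' u = 0 -> annihilation beta r' w = 0.
  by move=> E0; rewrite annihilation_comm -shift_annihilation E0 !linear0.
case: p1 => [|p1]; first by rewrite creation0 Ew.
rewrite (annihilation_creation _ _ _ beta_alpha) Ew // linear0 sub0r.
case: r {dr Er} Er1 => [|r] Er1; first by rewrite oppr0.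
by rewrite (Ew _ (Er1 _ erefl)) linear0 oppr0.
Qed.

Lemma annihilation_bounded_sub_W : F `<=` W.
Proof.
move=> v Fv; apply: is_subspace_charge => [|delta];
  first exact: W_cyclic_subspace.
have [[j dj]|no] := pselect (exists j : nat, delta = charge j%:R).
  apply: (@annihilation_kernel_W j); first by rewrite -dj charge_proj_id eqxx.
  move=> r jr; apply: Fv => i; rewrite dj => /charge_inj /eqP.
  by rewrite eqr_nat => /eqP <-.
have := Fv delta 0 _; rewrite annihilation0 => -> => [|j dj].
  exact: (W_cyclic_subspace _ _).1.
by case: no; exists j.
Qed.

Lemma W_sub_annihilation_bounded n :
  W_cyclic form alpha (charge n%:R) `<=` F.
Proof.
apply: W_cyclic_min annihilation_bounded_subspace annihilation_bounded_stable _.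
exact: annihilation_bounded_e_vec.
Qed.

Local Notation S := [set delta | exists z : int, delta = charge z%:~R].

Lemma annihilation_bounded_V_sub : F `<=` V_sub S.
Proof.
move=> v Fv; apply/V_subP => delta Sd; rewrite -[LHS](annihilation0 beta).
by apply: Fv => j dj; case: Sd; exists j%:Z.
Qed.

(** Every term of e^beta(k + n) on the component of charge j >= 0 contains some
    E_r with r >= j + n + 1. *)
Lemma annihilation_bounded_kernel v (n : nat) : F v ->
  vop beta (k + n%:R) v = 0.
Proof.
move=> Fv; apply: charge_proj_ext => delta; rewrite linear0 charge_proj_vop.
set eta := delta - beta; set u := charge_proj eta v.
have du : charge_proj eta u = u by rewrite charge_proj_id eqxx.
have [s sI ->] := vop_finite_sum beta (k + n%:R) du.
rewrite big_seq big1 // => -[p1 p2] /sI; rewrite /vop_index /= => Ip.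
rewrite vop_termE -shift_annihilation Fv ?linear0 // => j eta_j.
move: Ip; rewrite eta_j form_charge => Ip.
have /eqP : (p1 + j + n + 1)%:R = p2%:R :> C.
  rewrite !natrD; apply/eqP; rewrite -subr_eq0; apply/eqP.
  transitivity ((p1%:R - p2%:R + (j%:R - k)) - (- (k + n%:R) - 1));
    first by ring.
  by rewrite Ip subrr.
by rewrite eqr_nat => /eqP <-; rewrite addn1 ltnS -addnA addnCA leq_addr.
Qed.

(** The equations e^beta(k + n) u = 0 are triangular in the vectors E_r u: the
    one with r = z + 1 + n reads E_r u + (terms in E_s u with s > r) = 0, up
    to a shift.  They are solved from the top, where E_r u = 0 by weight.  For
    charges z < 0 the degree r = 0 is reached, so that u = 0. *)
Lemma kernel_annihilation_bounded v : V_sub S v ->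
  (forall n : nat, vop beta (k + n%:R) v = 0) -> F v.
Proof.
move=> /V_subP Sv Kv delta r; set u := charge_proj delta v.
have [[z dz]|no] := pselect (S delta); last by rewrite /u Sv // linear0.
move=> dr; have {dr} : z < r%:Z.
  by case: z dz => // j dj; have := dr j dj.
have du : charge_proj delta u = u by rewrite charge_proj_id eqxx.
have Ku n : vop beta (k + n%:R) u = 0.
  have := charge_proj_vop (beta + delta) beta (k + n%:R) v.
  by rewrite Kv linear0 addrAC subrr add0r.
have [[|N] uN] := wt_lt_exists u; first by rewrite (wt_lt0 uN) linear0.
suff E m : forall r, (N < r + m)%N -> z < r%:Z -> annihilation beta r u = 0.
  by apply: (E N.+1); rewrite leq_addl.
elim: m => [|m IHm] {}r Nr zr.
  by apply: (annihilation_wt _ uN); rewrite addn0 in Nr.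
have [n rn] : exists n : nat, r%:Z = z + 1 + n%:Z.
  by exists (absz (r%:Z - (z + 1))%R);
    rewrite gez0_abs ?subr_ge0 ?lezD1 // addrC subrK.
have rnC : r%:R = z%:~R + 1 + n%:R :> C.
  by rewrite -[LHS]/(r%:Z%:~R) rn !intrD.
have := Ku n; rewrite (@vop_neg _ _ delta r N.+1) //; last first.
  by rewrite dz form_charge rnC; ring.
rewrite big_ord_recl addn0 creation0 big1 ?addr0 => [|i _].
  by rewrite -shift_annihilation => /(congr1 (shift (- beta)));
    rewrite shiftK linear0.
rewrite -shift_annihilation IHm ?linear0 //.
  by rewrite (leq_trans Nr) // -addnA leq_add2l lift0 addSn ltnS leq_addl.
by rewrite (Order.POrderTheory.lt_trans zr) // ltz_nat lift0 addnS ltnS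
  leq_addr.
Qed.

(** * The kernels on V_sub and on the cyclic modules *)

Lemma V_sub_subspace (A : set h) : is_subspace (V_sub A : set V_h).
Proof.
split=> [|c u v /V_subP Au /V_subP Av]; apply/V_subP => delta Ad;
  first exact: linear0.
by rewrite linearP /= Au // Av // scaler0 addr0.
Qed.

Lemma W_sub_V_sub (z : int) : W_cyclic form alpha (charge z%:~R) `<=` V_sub S.
Proof.
apply: W_cyclic_min => [|n v /V_subP Sv|]; first exact: V_sub_subspace.
- apply/V_subP => delta Sd; rewrite charge_proj_vop Sv ?linear0 // => -[j dj].
  by case: Sd; exists (j + 1); rewrite intrD chargeS -dj addrC subrK.
- apply/V_subP => delta Sd; rewrite charge_proj_e_vec; case: eqP => // dz.
  by case: Sd; exists z.
Qed.

Lemma I_ker_V_sub : I_ker form beta k (V_sub S) = W.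
Proof.
apply/seteqP; split=> v => [[Sv Kv]|Wv].
  by apply: annihilation_bounded_sub_W; apply: kernel_annihilation_bounded.
have Fv : F v by apply: (@W_sub_annihilation_bounded 0).
by split=> [|n];
  [exact: annihilation_bounded_V_sub|exact: annihilation_bounded_kernel].
Qed.

Lemma I_ker_W_nonneg (n : nat) :
  I_ker form beta k (W_cyclic form alpha (charge n%:R)) =
  W_cyclic form alpha (charge n%:R).
Proof.
apply/seteqP; split=> v => [[]//|Wv]; split=> // j.
by apply: annihilation_bounded_kernel; apply: W_sub_annihilation_bounded Wv.
Qed.

(** The modes of e^alpha lead from charge - n up to charge 0, so this module
    contains the one generated in charge 0, which is the kernel already on the
    larger space V_sub. *)
Lemma I_ker_W_nonpos (n : nat) :
  I_ker form beta k (W_cyclic form alpha (charge (- n%:R))) = W.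
Proof.
apply/seteqP; split=> v => [[Wv Kv]|Wv].
  rewrite -I_ker_V_sub; split=> //; apply: (@W_sub_V_sub (- n%:Z)).
  by rewrite intrN.
split=> [|j]; last first.
  by apply: annihilation_bounded_kernel; apply: (@W_sub_annihilation_bounded 0).
apply: (W_cyclic_min _ _ _ Wv) => [||]; first exact: W_cyclic_subspace.
  by move=> i u; exact: W_cyclic_stable.
have -> : charge 0 = n%:R *: alpha + charge (- n%:R).
  by rewrite /charge -scalerDl addrA subrr.
exact: W_cyclic_e_vec.
Qed.

End Fock.

Theorem proposition8 (R : realType) (h : vectType (complex R))
    (form : {symmetric h})
    (dim_h : \dim {:h} = 1%N)
    (form_nondeg : nondegenerate form)
    (g : complex R) (g_neq0 : g != 0)
    (beta : h) (beta_g : form beta beta = g)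
    (k : complex R) :
  let beta0 := g^-1 *: beta in
  let W (mu : h) := W_cyclic form beta0 mu in
  let I := I_ker form beta k in
  (forall m : complex R,
     (exists z : int, m = - (g^-1 * k) + g^-1 * z%:~R) ->
     ((exists n : nat, g * m + k = n%:R) ->
        I (W (m *: beta)) = W (m *: beta)) /\
     ((exists n : nat, g * m + k = - n%:R) ->
        I (W (m *: beta)) = W ((- (g^-1 * k)) *: beta))) /\
  I (V_sub [set delta : h | exists z : int,
                              delta = z%:~R *: beta0 - k *: beta0])
    = W ((- (g^-1 * k)) *: beta).
Proof.
move=> beta0 W I.
have beta_beta0 : form beta beta0 = 1 by rewrite linearZ /= beta_g mulVf.
have charge_m m : m *: beta = charge beta0 k (g * m + k).
  by rewrite /charge addrK scalerA mulrAC divff ?mul1r.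
have charge_k : (- (g^-1 * k)) *: beta = charge beta0 k 0.
  by rewrite /charge sub0r scalerA mulNr mulrC.
rewrite {}/W {}/I charge_k; split=> [m _|].
  rewrite charge_m; split=> -[n ->]; first exact: I_ker_W_nonneg.
  exact: I_ker_W_nonpos.
rewrite -(I_ker_V_sub beta_beta0 dim_h); congr (I_ker _ _ _ (V_sub _)).
by apply/seteqP; split=> delta [z ->]; exists z; rewrite /charge scalerBl.
Qed.
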